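(* For any fixed $\varepsilon>0$ and any prime number $p$, the set $$\{xy\pmod p:\ 1\le x,y\le p^{1/2}(\log p)^{2+\varepsilon}\}$$ (with $x,y$ integers) contains $(1+o(1))p$ residue classes modulo $p$, as $p\to\infty$.
   Context: Here $o(1)$ denotes a quantity tending to $0$ as the prime $p$ tends to infinity, with $\varepsilon$ fixed. *)

(* Defs.v *)
From mathcomp Require Import all_boot all_order all_algebra.
From mathcomp Require Import all_classical all_reals all_analysis.

Set Implicit Arguments.
Unset Strict Implicit.
Unset Printing Implicit Defensive.

Import Order.TTheory GRing.Theory Num.Theory.
Import numFieldNormedType.Exports.

Local Open Scope classical_set_scope.
Local Open Scope ring_scope.

Definition box_bound (R : realType) (eps : R) (p : nat) : R :=
  p%:R `^ (1 / 2) * (ln p%:R) `^ (2 + eps).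

(* For p prime, 'F_p is the field of residue classes modulo p; for other p it
   is not Z/pZ, and the definition is only meant to be used at primes. *)
Definition product_residues (R : realType) (eps : R) (p : nat) : {set 'F_p} :=
  [set a : 'F_p | `[< exists x y : int,
    [/\ 1 <= x, x%:~R <= box_bound eps p,
        1 <= y, y%:~R <= box_bound eps p & a = (x * y)%:~R] >]]%SET.

(* Main.v *)
Require Import Defs.
From mathcomp Require Import all_boot all_order all_algebra.
From mathcomp Require Import all_classical all_reals all_analysis.
From mathcomp Require Import zify ring lra.

(** Put K = floor (sqrt p), M = floor (log_4 p), N = K M^2, and let x range over
    (K, 2K], y over [1, N]; then M <= ln p keeps both below the box bound.  By a
    variance argument it is enough that the number E of solutions of
    x1 y1 = x2 y2 mod p is at most (1 + o(1)) (K N)^2 / p.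
    For fixed x1, x2 with gcd g, write x1 = u g and x2 = v g.  The solutions
    (y1, y2) of u y1 = v y2 mod p in [1, N]^2 number at most
    (N / u + 1) ((u N + u v) / p + 1) = N^2 / p + O(K N / p) + N g / x1 + O(1).
    Summed over x1 and x2, the only delicate error is
    (N / K) sum gcd(x1, x2) = O(K N log K), which is O(1 / M) relative to
    (K N)^2 / p because N / K = M^2. *)

Set Implicit Arguments.
Unset Strict Implicit.
Unset Printing Implicit Defensive.

Import Order.TTheory GRing.Theory Num.Theory.
Import numFieldNormedType.Exports.

Local Open Scope ring_scope.

(** * Fibre sizes and their second moment *)

Definition collisions (T A : finType) (f : T -> A) : nat :=
  #|[set t : T * T | f t.1 == f t.2]|.

Lemma sum_card_fibres (T A : finType) (f : T -> A) :
  (\sum_a #|[set t | f t == a]| = #|T|)%N.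
Proof.
rewrite -sum1_card (partition_big f predT) //=.
by apply: eq_bigr => a _; rewrite sum1dep_card.
Qed.

Lemma sum_sqr_card_fibres (T A : finType) (f : T -> A) :
  (\sum_a #|[set t | f t == a]| ^ 2 = collisions f)%N.
Proof.
rewrite /collisions -sum1_card (partition_big (fun t => f t.1) predT) //=.
apply: eq_bigr => a _; rewrite sum1dep_card -mulnn -cardsX; apply: eq_card => t.
rewrite !inE; case: eqP => [-> /=|_ /=]; last by rewrite andbF.
by rewrite andbT eq_sym.
Qed.

(** With [r a] the size of the fibre over [a], the right side is the sum of
    [(#|A| * r a - #|T|) ^ 2] over all [a]. Each missed [a] has [r a = 0] and so contributes exactly
    [#|T| ^ 2]. *)
Lemma missed_le_variance (R : realDomainType) (T A : finType) (f : T -> A) :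
  (#|A|%:R - #|[set f t | t in T]|%:R) * #|T|%:R ^+ 2
    <= #|A|%:R * (#|A|%:R * (collisions f)%:R - #|T|%:R ^+ 2) :> R.
Proof.
pose r a := #|[set t | f t == a]|; pose S := [set f t | t in T].
have -> : #|A|%:R * (#|A|%:R * (collisions f)%:R - #|T|%:R ^+ 2)
    = \sum_a (#|A|%:R * (r a)%:R - #|T|%:R) ^+ 2 :> R.
  transitivity (\sum_a (#|A|%:R ^+ 2 * (r a ^ 2)%:R
      - 2 * #|A|%:R * #|T|%:R * (r a)%:R + #|T|%:R ^+ 2) : R); last first.
    by apply: eq_bigr => a _; rewrite natrX; ring.
  rewrite big_split sumrB /= -!mulr_sumr -!natr_sum sumr_const.
  by rewrite sum_sqr_card_fibres sum_card_fibres -[_ *+ #|_|]mulr_natl; ring.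
have -> : (#|A|%:R - #|S|%:R) * #|T|%:R ^+ 2
    = \sum_(a in ~: S) (#|A|%:R * (r a)%:R - #|T|%:R) ^+ 2 :> R.
  transitivity (\sum_(a in ~: S) #|T|%:R ^+ 2 : R).
    by rewrite sumr_const -[_ *+ #|_|]mulr_natl -(cardsC S) natrD; ring.
  apply: eq_bigr => a; rewrite inE => aS.
  suff -> : r a = 0%N by ring.
  apply/eqP; rewrite cards_eq0; apply/eqP/setP => t; rewrite !inE.
  by apply: contraNF aS => /eqP <-; apply: imset_f.
rewrite [leRHS](bigID (mem (~: S))) /= lerDl.
by apply: sumr_ge0 => a _; apply: sqr_ge0.
Qed.

(** * Solutions of a linear congruence in a box *)

Lemma eqn_modMl_coprime (d m a b : nat) : coprime d m ->
  (m * a == m * b %[mod d]) = (a == b %[mod d]).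
Proof.
move=> dm; wlog ba : a b / (b <= a)%N.
  by move=> h; case: (leqP b a) => [|/ltnW] /h // E; rewrite eq_sym E eq_sym.
by rewrite !eqn_mod_dvd ?leq_mul2l ?ba ?orbT // -mulnBr Gauss_dvdr.
Qed.

(* Writing y2 = j u + r with 0 <= r < u, the number W = u y1 + v (u - 1 - r) is
   fixed modulo p by j, and is at most u N + u v; so (j, W / p)
   determines W, then r = y2 mod u by coprimality, then y1. *)
Lemma card_modular_pairs (p u v N : nat) :
  (0 < p)%N -> (0 < u)%N -> coprime u v ->
  (#|[set y : 'I_N * 'I_N | u * y.1.+1 == v * y.2.+1 %[mod p]]|
    <= (N %/ u).+1 * ((u * N + u * v) %/ p).+1)%N.
Proof.
move=> p0 u0 uv.
have small a : (u.-1 - a < u)%N by clear - u0; lia.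
have subI a b : (a %% u < u -> b %% u < u -> u.-1 - a %% u = u.-1 - b %% u ->
    a %% u = b %% u)%N.
  by move: (a %% u)%N (b %% u)%N => {}a {}b; clear - u0; lia.
pose W (y : 'I_N * 'I_N) := (u * y.1.+1 + v * (u.-1 - y.2.+1 %% u))%N.
have Wp y : (W y %/ p < ((u * N + u * v) %/ p).+1)%N.
  rewrite ltnS leq_div2r // leq_add ?leq_mul2l ?ltn_ord ?orbT //.
  by rewrite mulnC leq_mul2r; apply/orP; right; lia.
have Jp (y : 'I_N * 'I_N) : (y.2.+1 %/ u < (N %/ u).+1)%N.
  by rewrite ltnS leq_div2r.
pose g y : 'I__ * 'I__ := (Ordinal (Jp y), Ordinal (Wp y)).
rewrite -[X in (_ <= X * _)%N]card_ord -[X in (_ <= _ * X)%N]card_ord -card_prod.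
apply: (@leq_card_in _ _ g) => y z; rewrite !inE => /eqP Hy /eqP Hz [Ej Ew].
have E (t : 'I_N * 'I_N) : u * t.1.+1 = v * t.2.+1 %[mod p] ->
  W t = v * (t.2.+1 %/ u * u + u.-1) %[mod p].
  move=> H; rewrite /W -modnDml H modnDml -mulnDr; congr (v * _ %% p)%N.
  by rewrite {1}(divn_eq t.2.+1 u) -addnA subnKC // -ltnS prednK // ltn_mod.
have {Ew} Ew : W y = W z.
  by rewrite (divn_eq (W y) p) (divn_eq (W z) p) Ew !E // Ej.
have Er : (y.2.+1 %% u = z.2.+1 %% u)%N.
  have ru t : (t %% u < u)%N by rewrite ltn_mod.
  have : v * (u.-1 - y.2.+1 %% u) = v * (u.-1 - z.2.+1 %% u) %[mod u].
    have : (W y %% u = W z %% u)%N by rewrite Ew.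
    by rewrite /W ![(u * _)%N]mulnC !modnMDl.
  move/eqP; rewrite eqn_modMl_coprime //.
  by rewrite !(modn_small (small _)) => /eqP; apply: subI; apply: ru.
have E2 : y.2.+1 = z.2.+1 by rewrite (divn_eq y.2.+1 u) (divn_eq z.2.+1 u) Ej Er.
have E1 : y.1.+1 = z.1.+1.
  by move: Ew; rewrite /W Er => /addIn /eqP; rewrite eqn_pmul2l // => /eqP.
case: y z E1 E2 {Hy Hz Ej Ew Er} => [a b] [c d] /= [] E1 [] E2.
by congr (_, _); apply: val_inj.
Qed.

(** * Divisor sums and the average of a gcd *)

(** A dyadic harmonic sum: the block [2 ^ k <= d < 2 ^ k.+1] has [2 ^ k] terms, each at most
    [n %/ 2 ^ k], so every block contributes at most [n]. *)
Lemma sum_divn_le (n k : nat) :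
  (\sum_(1 <= d < 2 ^ k) n %/ d <= n * k)%N.
Proof.
elim: k => [|k IH]; first by rewrite big_geq.
rewrite (big_cat_nat _ (n := 2 ^ k)) ?expn_gt0 ?leq_exp2l //= mulnS addnC leq_add //.
apply: (@leq_trans (\sum_(2 ^ k <= d < 2 ^ k.+1) n %/ 2 ^ k)%N).
  rewrite big_nat_cond [leqRHS]big_nat_cond; apply: leq_sum => d /andP[/andP[h _] _].
  by rewrite leq_div2l ?expn_gt0.
by rewrite sum_nat_const_nat expnS mul2n -addnn addnK mulnC leq_trunc_div.
Qed.

Lemma sum_gcdn_le (n k : nat) : (n < 2 ^ k)%N ->
  (\sum_(1 <= i < n.+1) \sum_(1 <= j < n.+1) gcdn i j <= n ^ 2 * k)%N.
Proof.
move=> nk.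
(* The gcd is one of the common divisors, hence at most their sum. After exchanging the sums, [d]
   contributes [d * (n %/ d) ^ 2], which is at most [n * (n %/ d)]. *)
apply: (@leq_trans (\sum_(1 <= i < n.+1) \sum_(1 <= j < n.+1)
   \sum_(1 <= d < n.+1) d * ((d %| i) * (d %| j)))%N).
  rewrite big_nat_cond [leqRHS]big_nat_cond; apply: leq_sum => i /andP[/andP[i0 iN] _].
  apply: leq_sum => j _.
  have g0 : (0 < gcdn i j)%N by rewrite gcdn_gt0 i0.
  have gn : (gcdn i j < n.+1)%N.
    by rewrite (leq_ltn_trans _ iN) // dvdn_leq // dvdn_gcdl.
  rewrite (big_cat_nat g0 (ltnW gn)) /=.
  rewrite [X in (_ + X)%N]big_ltn // dvdn_gcdl dvdn_gcdr !muln1.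
  by rewrite addnCA leq_addr.
under eq_bigr => i _ do rewrite exchange_big.
rewrite exchange_big /=.
apply: (@leq_trans (\sum_(1 <= d < n.+1) n * (n %/ d))%N).
  apply: leq_sum => d _.
  under eq_bigr => i _ do rewrite -big_distrr -big_distrr /= -divn_count_dvd.
  rewrite -big_distrr -big_distrl /= -divn_count_dvd mulnA leq_mul2r.
  by rewrite mulnC leq_trunc_div orbT.
rewrite -big_distrr /= -mulnn -mulnA leq_mul2l; apply/orP; right.
apply: leq_trans (sum_divn_le n k).
by rewrite [leqRHS](big_cat_nat _ (n := n.+1)) //= leq_addr.
Qed.

(** * Collisions among the products [x * y] modulo [p] *)

(* The indices are shifted so that x = K + i + 1 ranges over (K, 2K] and
   y = j + 1 over [1, N]. *)
Definition box_product (p K N : nat) (t : 'I_K * 'I_N) : 'F_p :=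
  ((K + t.1.+1) * t.2.+1)%:R.

Lemma natFp_eq (p m n : nat) : prime p ->
  (m%:R == n%:R :> 'F_p) = (m == n %[mod p])%N.
Proof. by move=> pp; rewrite -val_eqE /= !val_Fp_nat. Qed.

Lemma natr_divn_le (R : numFieldType) (m d : nat) :
  (m %/ d)%:R <= m%:R / d%:R :> R.
Proof.
case: d => [|d]; first by rewrite divn0 invr0 mulr0.
by rewrite ler_pdivlMr ?ltr0n // -natrM ler_nat leq_trunc_div.
Qed.

(** Since [0 < g < p], the factor [g] is invertible modulo [p] and cancels, leaving the coprime
    case. The right side is that bound without floors, times [p], expanded. *)
Lemma card_product_pairs (R : realFieldType) (p g u v N : nat) :
  prime p -> (0 < g < p)%N -> (0 < u)%N -> coprime u v ->
  #|[set y : 'I_N * 'I_N | u * g * y.1.+1 == v * g * y.2.+1 %[mod p]]|%:R * p%:R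
  <= N%:R ^+ 2 + N%:R * v%:R + N%:R * u%:R + u%:R * v%:R + p%:R
     + N%:R * p%:R / u%:R :> R.
Proof.
move=> pp /andP[g0 gp] u0 uv; have p0 := prime_gt0 pp.
have pg : coprime p g by rewrite prime_coprime // gtnNdvd.
have := card_modular_pairs N p0 u0 uv; set c := #|_| => hc.
have -> : #|[set y : 'I_N * 'I_N | u * g * y.1.+1 == v * g * y.2.+1 %[mod p]]| = c.
  apply: eq_card => y; rewrite !inE ![(_ * g)%N]mulnC -!mulnA.
  by rewrite eqn_modMl_coprime.
have {}hc : c%:R <= (N%:R / u%:R + 1) * ((u%:R * N%:R + u%:R * v%:R) / p%:R + 1) :> R.
  apply: (@le_trans _ _ ((N %/ u).+1 * ((u * N + u * v) %/ p).+1)%:R).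
    by rewrite ler_nat.
  rewrite natrM -!natr1 ler_pM ?addr_ge0 ?ler0n // lerD2r.
    exact: natr_divn_le.
  by rewrite -!natrM -natrD natr_divn_le.
have pR : 0 < p%:R :> R by rewrite ltr0n.
have uR : 0 < u%:R :> R by rewrite ltr0n.
rewrite -(ler_pM2r pR) in hc; apply: le_trans hc _.
rewrite le_eqVlt; apply/orP; left; apply/eqP.
field; by rewrite !gt_eqF.
Qed.

Lemma collisions_box_product_le (R : realFieldType) (p K N k : nat) :
  prime p -> (0 < K)%N -> (2 * K < p)%N -> (K ^ 2 <= p)%N -> (2 * K < 2 ^ k)%N ->
  (collisions (@box_product p K N))%:R * p%:R <=
    K%:R ^+ 2 * (N%:R ^+ 2 + 4 * K%:R * N%:R + 5 * p%:R)
    + 4 * K%:R * N%:R * k%:R * p%:R :> R.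
Proof.
move=> pp K0 Kp K2p Kk.
pose cnt (i j : 'I_K) := #|[set y : 'I_N * 'I_N |
  (K + i.+1) * y.1.+1 == (K + j.+1) * y.2.+1 %[mod p]]|.
have pR : 0 < p%:R :> R by rewrite ltr0n prime_gt0.
have KR : 0 < K%:R :> R by rewrite ltr0n.
have NR : 0 <= N%:R :> R by rewrite ler0n.
(* Collisions are sorted by their pair of [x]-indices. *)
have Hc : (collisions (@box_product p K N) <= \sum_i \sum_j cnt i j)%N.
  rewrite /collisions -sum1_card.
  rewrite (partition_big (fun t : ('I_K * 'I_N) * ('I_K * 'I_N) => (t.1.1, t.2.1)) predT) //=.
  rewrite pair_big /=; apply: leq_sum => -[i j] _ /=.
  rewrite sum1dep_card.
  pose h (y : 'I_N * 'I_N) := ((i, y.1), (j, y.2)).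
  apply: leq_trans (leq_imset_card h _); apply: subset_leq_card.
  apply/fintype.subsetP => -[[a b] [c d]]; rewrite !inE /=.
  rewrite /box_product natFp_eq //= => /andP[H /eqP[Ea Ec]]; subst a c.
  by apply/imsetP; exists (b, d); rewrite ?inE.
have Hp (i j : 'I_K) : (cnt i j)%:R * p%:R <= N%:R ^+ 2 + 4 * K%:R * N%:R + 5 * p%:R
    + N%:R * p%:R / K%:R * (gcdn (K + i.+1) (K + j.+1))%:R :> R.
  have i2 : (K + i.+1 <= 2 * K)%N by rewrite mul2n -addnn leq_add2l.
  have j2 : (K + j.+1 <= 2 * K)%N by rewrite mul2n -addnn leq_add2l.
  pose g := gcdn (K + i.+1) (K + j.+1).
  have g0 : (0 < g)%N by rewrite gcdn_gt0 addnS.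
  have gi : (g <= K + i.+1)%N by rewrite dvdn_leq ?dvdn_gcdl // addnS.
  have gp : (0 < g < p)%N by rewrite g0 (leq_ltn_trans (leq_trans gi i2)).
  have [u Eu] : exists u, (K + i.+1 = u * g)%N by apply/dvdnP/dvdn_gcdl.
  have [v Ev] : exists v, (K + j.+1 = v * g)%N by apply/dvdnP/dvdn_gcdr.
  have u0 : (0 < u)%N by case: u Eu => //; rewrite mul0n addnS.
  have uv : coprime u v.
    by rewrite /coprime -(eqn_pmul2r g0) muln_gcdl -Eu -Ev mul1n.
  have := @card_product_pairs R p g u v N pp gp u0 uv.
  rewrite -Eu -Ev -/(cnt i j) -/g => H; apply: le_trans H _.
  have u2 : u%:R <= 2 * K%:R :> R.
    by rewrite -natrM ler_nat (leq_trans _ i2) // Eu leq_pmulr.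
  have v2 : v%:R <= 2 * K%:R :> R.
    by rewrite -natrM ler_nat (leq_trans _ j2) // Ev leq_pmulr.
  have uv4 : u%:R * v%:R <= 4 * p%:R :> R.
    apply: (@le_trans _ _ ((2 * K%:R) * (2 * K%:R))).
      by rewrite ler_pM ?ler0n.
    by move: K2p; rewrite -(ler_nat R) natrX expr2; lra.
  (* Here [u * g = K + i.+1] is at least [K], so [1 / u <= g / K]. *)
  have H1 : N%:R * p%:R / u%:R <= N%:R * p%:R / K%:R * g%:R :> R.
    rewrite ler_pdivrMr ?ltr0n //.
    have -> : N%:R * p%:R / K%:R * g%:R * u%:R = N%:R * p%:R * (u%:R * g%:R / K%:R) :> R.
      by ring.
    rewrite ler_peMr ?mulr_ge0 ?ler0n // ler_pdivlMr // mul1r -natrM ler_nat.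
    by rewrite -Eu leq_addr.
  have Nv : N%:R * v%:R <= N%:R * (2 * K%:R) :> R by rewrite ler_wpM2l.
  have Nu : N%:R * u%:R <= N%:R * (2 * K%:R) :> R by rewrite ler_wpM2l.
  lra.
(* Both indices are enlarged from [(K, 2K]] to [[1, 2K]], where [sum_gcdn_le] applies. *)
have G : \sum_(i < K) \sum_(j < K) (gcdn (K + i.+1) (K + j.+1))%:R
    <= 4 * K%:R ^+ 2 * k%:R :> R.
  apply: (@le_trans _ _ ((2 * K) ^ 2 * k)%:R); last by rewrite natrM natrX natrM; lra.
  have -> : \sum_(i < K) \sum_(j < K) (gcdn (K + i.+1) (K + j.+1))%:R
    = (\sum_(i < K) \sum_(j < K) gcdn (K + i.+1) (K + j.+1))%:R :> R.
    by rewrite natr_sum; apply: eq_bigr => i _; rewrite natr_sum.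
  rewrite ler_nat; apply: leq_trans (sum_gcdn_le Kk).
  have sub (F : nat -> nat) :
      (\sum_(i < K) F (K + i.+1) <= \sum_(1 <= i < (2 * K).+1) F i)%N.
    rewrite (big_cat_nat _ (n := K.+1)) //=; last by lia.
    apply: leq_trans (leq_addl _ _).
    rewrite -[K.+1]add0n big_addn big_mkord.
    have -> : ((2 * K).+1 - K.+1 = K)%N by lia.
    by apply: leq_sum => i _; rewrite addnC addSnnS.
  apply: leq_trans (sub (fun i => \sum_(1 <= j < (2 * K).+1) gcdn i j)%N).
  by apply: leq_sum => i _; apply: (sub (gcdn (K + i.+1))).
apply: (@le_trans _ _ (\sum_(i < K) \sum_(j < K) (cnt i j)%:R * p%:R)).
  under eq_bigr => i _ do rewrite -mulr_suml.
  rewrite -mulr_suml ler_pM2r //.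
  under eq_bigr => i _ do rewrite -natr_sum.
  by rewrite -natr_sum ler_nat.
apply: (@le_trans _ _ (\sum_(i < K) \sum_(j < K) (N%:R ^+ 2 + 4 * K%:R * N%:R + 5 * p%:R
    + N%:R * p%:R / K%:R * (gcdn (K + i.+1) (K + j.+1))%:R))).
  by apply: ler_sum => i _; apply: ler_sum => j _; apply: Hp.
under eq_bigr => i _ do rewrite big_split /= -mulr_sumr sumr_const card_ord.
rewrite big_split /= -mulr_sumr sumr_const card_ord -mulrnA mulnn -[_ *+ (K ^ 2)]mulr_natl natrX lerD2l.
apply: (@le_trans _ _ (N%:R * p%:R / K%:R * (4 * K%:R ^+ 2 * k%:R))).
  by rewrite ler_wpM2l // divr_ge0 ?mulr_ge0 // ltW.
rewrite le_eqVlt; apply/orP; left; apply/eqP; field.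
by rewrite gt_eqF.
Qed.

(** With [N = K * L], the main term of the collision bound cancels in the variance. Division by
    [(K * N) ^ 2] and [p <= 4 * K ^ 2] then remove [K] from the other terms. *)
Lemma card_box_products_ge (R : realFieldType) (p K L k : nat) :
  prime p -> (0 < K)%N -> (0 < L)%N -> (2 * K < p)%N -> (K ^ 2 <= p <= 4 * K ^ 2)%N ->
  (2 * K < 2 ^ k)%N ->
  p%:R - #|[set box_product p t | t in {: 'I_K * 'I_(K * L)}]|%:R
  <= p%:R * (4 / L%:R + 20 / L%:R ^+ 2 + 16 * k%:R / L%:R) :> R.
Proof.
move=> pp K0 L0 Kp /andP[K2p pK2] Kk.
have := @missed_le_variance R _ _ (@box_product p K (K * L)).
rewrite card_Fp // card_prod !card_ord.
have := @collisions_box_product_le R p K (K * L) k pp K0 Kp K2p Kk.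
set S := [set _ | _ in _]; set E := collisions _; set d := (_ - _ in X in _ -> X).
have pR : 0 < p%:R :> R by rewrite ltr0n prime_gt0.
have KR : 0 < K%:R :> R by rewrite ltr0n.
have LR : 0 < L%:R :> R by rewrite ltr0n.
have {}pK2 : p%:R <= 4 * K%:R ^+ 2 :> R by rewrite -natrX -natrM ler_nat.
rewrite !natrM [X in X <= _ -> _]mulrC => HE Hd.
have T0 : 0 < (K%:R * (K%:R * L%:R)) ^+ 2 :> R by rewrite exprn_gt0 ?mulr_gt0.
rewrite -(ler_pM2r T0); apply: le_trans Hd _.
rewrite -[leRHS]mulrA ler_pM2l //.
rewrite lerBlDr; apply: le_trans HE _.
have h1 : 5 * p%:R * K%:R ^+ 2 <= 20 * K%:R ^+ 4 :> R.
  by have := ler_wpM2r (exprn_ge0 2 (ltW KR)) pK2; lra.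
have h2 : 4 * K%:R * (K%:R * L%:R) * k%:R * p%:R <= 16 * K%:R ^+ 4 * L%:R * k%:R :> R.
  have : 0 <= 4 * K%:R * (K%:R * L%:R) * k%:R :> R by rewrite !mulr_ge0 // ltW.
  by move/ler_wpM2l => /(_ _ _ pK2); lra.
have -> : (4 / L%:R + 20 / L%:R ^+ 2 + 16 * k%:R / L%:R) * (K%:R * (K%:R * L%:R)) ^+ 2
  = 4 * K%:R ^+ 4 * L%:R + 20 * K%:R ^+ 4 + 16 * K%:R ^+ 4 * L%:R * k%:R :> R.
  by field; rewrite gt_eqF.
lra.
Qed.

(** * Choice of parameters and passage to the limit *)

Lemma floor_sqrtn (n : nat) : exists K, (K ^ 2 <= n < K.+1 ^ 2)%N.
Proof.
elim: n => [|n [K /andP[lo hi]]]; first by exists 0%N.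
have [hi'|hi'] := ltnP n.+1 (K.+1 ^ 2); first by exists K; rewrite leqW.
exists K.+1; rewrite hi' /=; apply: leq_ltn_trans hi _.
by rewrite ltn_sqr.
Qed.

Lemma trunc_log4_le_ln (R : realType) (n : nat) :
  (0 < n)%N -> (trunc_log 4 n)%:R <= ln n%:R :> R.
Proof.
move=> n0; set M := trunc_log 4 n.
(* From [ln (1 / 2) <= - 1 / 2] one gets [ln 2 >= 1 / 2], and [ln 4 = 2 * ln 2]. *)
have ln4 : 1 <= ln 4 :> R.
  have : ln (1 + - (1 / 2)) <= - (1 / 2) :> R by apply: le_ln1Dx; lra.
  have -> : 1 + - (1 / 2) = 2^-1 :> R by lra.
  rewrite lnV ?posrE // => h.
  have -> : 4 = 2 ^+ 2 :> R by ring.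
  by rewrite lnXn // mulr2n; lra.
apply: (@le_trans _ _ (ln (4 ^+ M))).
  by rewrite lnXn // -[leRHS]mulr_natl ler_peMr.
rewrite ler_ln ?posrE ?exprn_gt0 ?ltr0n // -natrX ler_nat.
exact: trunc_logP.
Qed.

Local Open Scope classical_set_scope.
Local Open Scope ring_scope.

Lemma box_products_sub (R : realType) (eps : R) (p K : nat) :
  0 < eps -> prime p -> (2 <= trunc_log 4 p)%N -> (K ^ 2 <= p)%N ->
  [set box_product p t | t in {: 'I_K * 'I_(K * trunc_log 4 p ^ 2)}]%SET
    \subset product_residues eps p.
Proof.
move=> eps0 pp M2 Kp; set M := trunc_log 4 p in M2 *.
have Mln : M%:R <= ln p%:R :> R by apply: trunc_log4_le_ln; apply: prime_gt0.
have bnd (n : nat) : (n <= K * M ^ 2)%N -> n%:Z%:~R <= box_bound eps p.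
  move=> nK; apply: (@le_trans _ _ (K%:R * M%:R ^+ 2)).
    by rewrite -natrX -natrM ler_nat.
  have M1 : 1 <= M%:R :> R by rewrite ler1n ltnW.
  rewrite /box_bound ler_pM ?exprn_ge0 ?ler0n //.
    rewrite mul1r powR12_sqrt // -(@ler_pXn2r _ 2) ?nnegrE ?sqrtr_ge0 //.
    by rewrite sqr_sqrtr // -natrX ler_nat.
  (* Raising the exponent from [2] to [2 + eps] needs [ln p >= 1], which follows from
     [1 <= M <= ln p]. *)
  apply: (@le_trans _ _ (ln p%:R ^+ 2)).
    by rewrite lerXn2r ?nnegrE ?(le_trans _ Mln).
  rewrite -powR_mulrn ?(le_trans _ Mln) // ler_powR ?(le_trans M1) //.
  by rewrite lerDl ltW.
apply/fintype.subsetP => _ /imsetP[[i j] _ ->]; rewrite inE; apply/asboolP.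
exists (K + i.+1)%N%:Z, j.+1%:Z; split => //; first by rewrite addnS.
(* As [M >= 2], [x <= 2 * K <= K * M ^ 2], so one bound serves both factors. *)
- apply: bnd; apply: (@leq_trans (K * 2)); first by rewrite muln2 -addnn leq_add2l.
  by rewrite leq_mul2l -mulnn (leq_trans M2) ?orbT // leq_pmull // ltnW.
- by apply: bnd; apply: ltn_ord.
Qed.

Lemma card_product_residues_ge (R : realType) (eps : R) (p : nat) :
  0 < eps -> prime p -> (2 <= trunc_log 4 p)%N ->
  p%:R - #|product_residues eps p|%:R <= p%:R * (40 / (trunc_log 4 p)%:R) :> R.
Proof.
move=> eps0 pp M2; have [K /andP[K2p pK2]] := floor_sqrtn p.
have p0 := prime_gt0 pp.
have sub := subset_leq_card (box_products_sub eps0 pp M2 K2p).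
set M := trunc_log 4 p in M2 sub *.
have /andP[Mp pM] : (4 ^ M <= p < 4 ^ M.+1)%N by apply: trunc_log_bounds.
have p16 : (16 <= p)%N by apply: leq_trans Mp; rewrite (@leq_exp2l 4 2).
have K0 : (0 < K)%N by case: K pK2 {K2p sub} => //; lia.
have Kp : (2 * K < p)%N by nia.
have p4 : (K ^ 2 <= p <= 4 * K ^ 2)%N by rewrite K2p /=; nia.
(* Squaring, [K ^ 2 <= p < 4 ^ M.+1]; hence the choice [k = M + 2]. *)
have Kk : (2 * K < 2 ^ M.+2)%N.
  rewrite expnS ltn_mul2l /= -ltn_sqr -expnM mulnC expnM.
  exact: leq_ltn_trans K2p pM.
have L0 : (0 < M ^ 2)%N by rewrite expn_gt0 ltnW.
have := @card_box_products_ge R p K (M ^ 2) M.+2 pp K0 L0 Kp p4 Kk.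
move=> H; apply: le_trans (le_trans H _).
  by rewrite lerD2l lerN2 ler_nat.
rewrite ler_wpM2l // !natrX -[M.+2]addn2 natrD.
have {M2} M2 : 2 <= M%:R :> R by rewrite ler_nat.
move: (M%:R : R) M2 => x x2; have x0 : 0 < x by lra.
have -> : 4 / x ^+ 2 + 20 / (x ^+ 2) ^+ 2 + 16 * (x + 2) / x ^+ 2
  = (4 * x ^+ 2 + 20 + 16 * (x + 2) * x ^+ 2) / x ^+ 4 by field; rewrite gt_eqF.
rewrite ler_pdivrMr ?exprn_gt0 //.
have -> : 40 / x * x ^+ 4 = 40 * x ^+ 3 by field; rewrite gt_eqF.
(* The claim is [36 * x ^ 2 + 20 <= 24 * x ^ 3], true for [x >= 2]; this fixes the constant [40]. *)
nra.
Qed.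

Theorem corollary5 (R : realType) (eps : R) (heps : 0 < eps) :
  exists o : nat -> R,
    o p @[p --> within [set p : nat | prime p] \oo] --> (0 : R) /\
    (forall p : nat, prime p ->
       #|product_residues eps p|%:R = (1 + o p) * p%:R).
Proof.
exists (fun p => #|product_residues eps p|%:R / p%:R - 1); split; last first.
  move=> p /prime_gt0 p0; rewrite addrCA subrr addr0 divfK //.
  by rewrite pnatr_eq0 -lt0n.
apply/cvgrPdist_le => e e0; rewrite near_withinE.
have [m me] : exists m : nat, 40 / e <= m%:R.
  by exists (Num.Def.truncn (40 / e)).+1; rewrite ltW // truncnS_gt.
near=> p => pp.
(* It suffices that [p >= 4 ^ maxn m 2]. *)
have Mp : (maxn m 2 <= trunc_log 4 p)%N.
  by apply: trunc_log_max => //; near: p; apply: nbhs_infty_ge.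
have := @card_product_residues_ge R eps p heps pp (leq_trans (leq_maxr _ _) Mp).
have pR : 0 < p%:R :> R by rewrite ltr0n prime_gt0.
(* This gives the error term its sign, so only the lower bound on the cardinal remains. *)
have cp : #|product_residues eps p|%:R <= p%:R :> R.
  by rewrite ler_nat -[leqRHS](card_Fp pp) max_card.
have Me : 40 / (trunc_log 4 p)%:R <= e.
  have mM : m%:R <= (trunc_log 4 p)%:R :> R.
    by rewrite ler_nat (leq_trans (leq_maxl _ _) Mp).
  have M0 : 0 < (trunc_log 4 p)%:R :> R.
    by rewrite ltr0n (leq_trans _ (leq_trans (leq_maxr m 2) Mp)).
  by rewrite ler_pdivrMr // mulrC -ler_pdivrMr // (le_trans me).
move=> H; have {H Me} H := le_trans H (ler_wpM2l (ltW pR) Me).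
rewrite sub0r opprB ger0_norm; last by rewrite subr_ge0 ler_pdivrMr ?mul1r.
by rewrite lerBlDr -lerBlDl ler_pdivlMr //; lra.
Unshelve. all: by end_near.
Qed.
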